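(* For every integer $n\ge 1$, the number of spanning trees of the linear crossed octagonal-quadrilateral network $Q_n$ is $$\tau(Q_n)=2^{10n+2}\cdot 3^{2n-1}.$$
   Context: Definition of $Q_n$ (for an integer $n\ge 1$). The linear crossed octagonal-quadrilateral network $Q_n$ is the simple undirected graph with the $8n+2$ vertices $1,2,\ldots,4n+1$ and $1',2',\ldots,(4n+1)'$, and exactly the following $18n+1$ edges: (i) $\{i,i+1\}$ and $\{i',(i+1)'\}$ for $1\le i\le 4n$; (ii) the crossing edges $\{i,(i+1)'\}$ and $\{i',i+1\}$ for $1\le i\le 4n$; (iii) the rungs $\{1,1'\}$, and $\{4k,(4k)'\}$ and $\{4k+1,(4k+1)'\}$ for $1\le k\le n$. $\tau(G)$ denotes the number of spanning trees of a graph $G$ (with labelled vertices). *)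

(* Defs.v *)
From mathcomp Require Import all_boot.

Set Implicit Arguments.
Unset Strict Implicit.
Unset Printing Implicit Defensive.

Record sgraph := SGraph {
  vertex :> finType;
  adj : rel vertex;
  adj_sym : symmetric adj;
  adj_irrefl : irreflexive adj }.

Definition edges (G : sgraph) : {set {set G}} :=
  [set [set x; y] | x in G, y in G & adj x y].

Definition connected (G : sgraph) : bool :=
  [forall x : G, forall y : G, connect (@adj G) x y].

(* A cycle is a sequence of at least 3 distinct vertices, cyclically adjacent.
   Such a sequence has size at most #|G|, which makes the quantification
   finite; see acyclicP. *)
Definition acyclic (G : sgraph) : bool :=
  [forall k : 'I_#|G|.+1, forall c : k.-tuple G,
    ~~ [&& 2 < size c, uniq c & cycle (@adj G) c]].

Lemma acyclicP (G : sgraph) :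
  reflect (forall c : seq G, ~~ [&& 2 < size c, uniq c & cycle (@adj G) c])
          (acyclic G).
Proof.
apply: (iffP forallP) => [acG c | acG k]; last by apply/forallP => c.
apply/negP => /and3P[c3 Uc Cc].
have lt_c : size c < #|G|.+1 by rewrite ltnS -(card_uniqP Uc) max_card.
by have /forallP/(_ (in_tuple c)) := acG (Ordinal lt_c); rewrite c3 Uc Cc.
Qed.

Definition tree (G : sgraph) : bool := connected G && acyclic G.

Section SpanningSubgraph.
Variables (G : sgraph) (F : {set {set G}}).

Definition spanning_adj : rel G := fun x y => (x != y) && ([set x; y] \in F).

Lemma spanning_adj_sym : symmetric spanning_adj.
Proof. by move=> x y; rewrite /spanning_adj eq_sym setUC. Qed.

Lemma spanning_adj_irrefl : irreflexive spanning_adj.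
Proof. by move=> x; rewrite /spanning_adj eqxx. Qed.

Definition spanning_subgraph : sgraph :=
  SGraph spanning_adj_sym spanning_adj_irrefl.

End SpanningSubgraph.

(* A spanning tree is identified with its edge set. *)
Definition spanning_trees (G : sgraph) : {set {set {set G}}} :=
  [set F : {set {set G}} | (F \subset edges G) && tree (spanning_subgraph F)].

Definition tau (G : sgraph) : nat := #|spanning_trees G|.

Section Qn.
Variable n : nat.

(* (i, false) stands for the vertex i + 1 and (i, true) for (i + 1)'. *)
Definition Qvertex : finType := ('I_(4 * n + 1) * bool)%type.

Definition label (u : Qvertex) : nat := u.1.+1.
Definition primed (u : Qvertex) : bool := u.2.

Definition Qpath (u v : Qvertex) : bool :=
  (label v == label u + 1) && (primed u == primed v).

Definition Qcross (u v : Qvertex) : bool :=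
  (label v == label u + 1) && (primed u != primed v).

Definition is_rung (i : nat) : bool :=
  (i == 1) ||
  [exists k : 'I_n.+1, (0 < k) && ((i == 4 * k) || (i == 4 * k + 1))].

Definition Qrung (u v : Qvertex) : bool :=
  [&& label u == label v, primed u != primed v & is_rung (label u)].

Definition Qarc (u v : Qvertex) : bool :=
  [|| Qpath u v, Qcross u v | Qrung u v].

Definition Qadj : rel Qvertex := fun u v => Qarc u v || Qarc v u.

Lemma Qadj_sym : symmetric Qadj.
Proof. by move=> u v; rewrite /Qadj orbC. Qed.

Lemma Qadj_irrefl : irreflexive Qadj.
Proof.
move=> u; rewrite /Qadj orbb /Qarc /Qpath /Qcross /Qrung !eqxx /= andbF !orbF.
by rewrite addn1 (ltn_eqF (ltnSn _)).
Qed.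

Definition Q : sgraph := SGraph Qadj_sym Qadj_irrefl.

End Qn.

(* Main.v *)
Require Import Defs.
From mathcomp Require Import all_boot all_order all_fingroup all_algebra.
From mathcomp Require Import zify ring.

(** The count is a determinant, computed by a symmetry of the network.

    Matrix-tree part. Orient every edge of a spanning tree towards a root [r]:
    the tree becomes a parent function [f] whose iterates all reach [r], and
    this is a bijection ([parent_edges_inj], [spanning_tree_parent_edges]).
    In the Laplacian with row [r] replaced by the unit vector of [r], the row
    of [x != r] is the sum over the neighbours [u] of [x] of [e_x - e_u], so by
    multilinearity the determinant is a sum over all ways [f] of choosing one
    neighbour per vertex. The term of [f] is 1 if [f] always reaches [r],
    because the matrix is then unitriangular for the distance to [r], and 0
    otherwise, because the indicator of the vertices that never reach [r] is in
    the kernel ([det_parent_row]). Hence [matrix_tree].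

    Evaluation part. [Q n] is a path of [4 * n + 1] layers [{i, i'}], and
    swapping the two twins of any single layer is an automorphism, so the
    vector [a_k = e_(k,true) - e_(k,false)] is an eigenvector of the Laplacian,
    with eigenvalue [c_k] equal to 4 or 6 inside and to 4 at both ends. On
    vectors constant on layers the Laplacian is twice that of a path, for which
    the indicators [s_k] of the layers from [k] on give a bidiagonal matrix.
    Multiplying the rooted Laplacian by the matrix of these vectors on one
    side, and adding in each layer the row of one twin to that of the other,
    thus produces a matrix that is triangular for a suitable order
    ([det_triangular_form]). What remains is a product over the layers, of
    period 4 away from the two ends ([prod_layer_pivot]). *)

Set Implicit Arguments.
Unset Strict Implicit.
Unset Printing Implicit Defensive.

Import GRing.Theory Num.Theory.
Local Open Scope ring_scope.

(** * Determinants of matrices indexed by a finite type *)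

Section FinMatrix.
Variables (R : comNzRingType) (T : finType).
Implicit Types (A B : T -> T -> R).

Definition fmx A : 'M[R]_#|T| := \matrix_(i, j) A (enum_val i) (enum_val j).

Lemma fmx_mul A B : fmx A *m fmx B = fmx (fun x y => \sum_z A x z * B z y).
Proof.
apply/matrixP => i j; rewrite !mxE (reindex (@enum_val T T)) /=.
  by apply: eq_bigr => k _; rewrite !mxE.
exact/onW_bij/enum_val_bij.
Qed.

Lemma eq_fmx A B : (forall x y, A x y = B x y) -> fmx A = fmx B.
Proof. by move=> eqAB; apply/matrixP => i j; rewrite !mxE. Qed.

Lemma det_fmx A :
  \det (fmx A) = \sum_(s : 'S_#|T|) (-1) ^+ s *
                   \prod_x A x (enum_val (s (enum_rank x))).
Proof.
apply: eq_bigr => s _; congr (_ * _).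
rewrite [RHS](reindex (@enum_val T T)) /=; last exact/onW_bij/enum_val_bij.
by apply: eq_bigr => i _; rewrite !mxE enum_valK.
Qed.

(** Triangularity for the preorder given by a rank. Along a permutation that
    contributes to the determinant the rank never increases; its total is
    preserved, so it is constant, which leaves only the identity. No enumeration
    compatible with the rank has to be chosen. *)
Lemma det_fmx_ranked A (d : T -> nat) :
    (forall x y, A x y != 0 -> x = y \/ (d y < d x)%N) ->
  \det (fmx A) = \prod_x A x x.
Proof.
move=> Ad; rewrite det_fmx (bigD1 1%g) //= odd_perm1 mul1r.
rewrite [X in _ + X]big1 => [|s /eqP s_neq1].
  by rewrite addr0; apply: eq_bigr => x _; rewrite perm1 enum_rankK.
set t := fun x => enum_val (s (enum_rank x)).
have [/forallP nzA | /forallPn[x]] := 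
    boolP [forall x, A x (t x) != 0]; last first.
  by rewrite negbK => /eqP Ax0; rewrite (bigD1 x) //= -/(t x) Ax0 mul0r mulr0.
have t_bij : bijective t.
  apply: bij_comp; first exact: enum_val_bij.
  apply: bij_comp; last exact: enum_rank_bij.
  exact/injF_bij/perm_inj.
have le_dt x : (d (t x) <= d x ?= iff (d (t x) == d x))%N.
  by split=> //; have [<- | /ltnW] := Ad _ _ (nzA x).
have [_] := leqif_sum (fun x (_ : predT x) => le_dt x).
rewrite [X in _ == X](reindex t) /=; last exact: onW_bij.
rewrite eqxx => /esym/forall_inP dt.
case: s_neq1; apply/permP => i; rewrite perm1; apply: enum_val_inj.
have := Ad _ _ (nzA (enum_val i)); rewrite /t enum_valK => -[<- // |].
by have /eqP := dt (enum_val i) isT; rewrite /t enum_valK => ->; rewrite ltnn.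
Qed.

(** One coordinate equal to 1 replaces the integrality of the ring in the usual
    argument: multiplying by the adjugate gives [\det A * v x0 = 0]. *)
Lemma det_fmx_kernel A (v : T -> R) x0 :
    v x0 = 1 -> (forall x, \sum_y A x y * v y = 0) -> \det (fmx A) = 0.
Proof.
move=> v1 Av0; pose w := \col_(j < #|T|) v (enum_val j).
have Aw : fmx A *m w = 0.
  apply/matrixP => i j; rewrite !mxE -[RHS](Av0 (enum_val i)).
  rewrite [RHS](reindex (@enum_val T T)) /=; last exact/onW_bij/enum_val_bij.
  by apply: eq_bigr => k _; rewrite !mxE.
have := mul_adj_mx (fmx A) => /(congr1 (mulmx^~ w)).
rewrite -mulmxA Aw mulmx0 mul_scalar_mx => /matrixP/(_ (enum_rank x0) 0).
by rewrite !mxE enum_rankK v1 mulr1.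
Qed.

(** Multilinearity in all the rows at once. *)
Lemma det_fmx_rows (ok : T -> pred T) (F : T -> T -> T -> R) :
  \det (fmx (fun x y => \sum_(u | ok x u) F x u y)) =
    \sum_(f in family ok) \det (fmx (fun x y => F x (f x) y)).
Proof.
rewrite det_fmx.
under eq_bigr => s _ do rewrite bigA_distr_big_dep mulr_sumr.
by rewrite exchange_big; apply: eq_bigr => f _; rewrite det_fmx.
Qed.
End FinMatrix.

(** * The matrix-tree theorem *)

Lemma next_neq_prev (T : eqType) (c : seq T) x :
  (2 < size c)%N -> uniq c -> x \in c -> next c x != prev c x.
Proof.
move=> c3 Uc /rot_to[i c' cE]; rewrite -(next_rot i) // -(prev_rot i) //.
move: c3 Uc; rewrite -(size_rot i) -(rot_uniq i) cE.
case: c' {cE} => [|y [|z s]] // _ /andP[x_notin /andP[y_notin _]].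
rewrite next_nth prev_nth mem_head (memNindex x_notin).
have /= -> := nth_last x [:: x, y, z & s]; rewrite /= eqxx /=.
by apply: contraNneq y_notin => ->; apply: mem_last.
Qed.

Section MatrixTree.
Variables (G : sgraph) (r : G).
Implicit Types (f g : {ffun G -> G}) (F : {set {set G}}).

(** The root is its own parent, so that parent functions are total and have
    [r] as their only possible fixed point. *)
Definition parent_ok (x : G) : pred G :=
  fun u => if x == r then u == r else adj x u.

Definition reaches_root f := [forall x, fconnect f x r].

Definition parent_functions : {set {ffun G -> G}} :=
  [set f in family parent_ok | reaches_root f].

Lemma fconnect_step (f : G -> G) x :
  x != r -> fconnect f (f x) r = fconnect f x r.
Proof.
move=> xr; apply/idP/idP => [|xc]; first exact/connect_trans/fconnect1.
have := iter_findex xc; case: findex => [/= x_r | k].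
  by rewrite x_r eqxx in xr.
by rewrite iterSr => <-; apply: fconnect_iter.
Qed.

(** The distance to the root along [f] drives the inductions on parent functions
    and is the rank that makes their matrices triangular. *)
Lemma reaches_root_depth f : reaches_root f ->
  exists d : G -> nat, forall x, x != r -> (d (f x) < d x)%N.
Proof.
move=> /forallP fr.
have ex x : exists k, iter k f x == r.
  by exists (findex f x r); rewrite iter_findex.
exists (fun x => ex_minn (ex x)) => x xr.
case: ex_minnP => k _ mink; case: ex_minnP => -[/= xr0 | l].
  by rewrite xr0 in xr.
by rewrite iterSr => /mink.
Qed.

(** One term of the expansion of the rooted Laplacian along its rows. *)
Definition parent_row f (x y : G) : int :=
  (y == x)%:R - ((x != r) && (y == f x))%:R.

(** The Laplacian with the row of [r] replaced by a unit vector: its determinant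
    is the minor obtained by deleting the row and the column of [r], without
    changing the index type. *)
Definition root_laplacian (x y : G) : int :=
  if x == r then (y == r)%:R
  else \sum_(u | adj x u) ((y == x)%:R - (y == u)%:R).

Lemma det_parent_row f : f \in family parent_ok ->
  \det (fmx (parent_row f)) = (reaches_root f)%:R.
Proof.
move=> /familyP okf; have [fr | /forallPn[x0 x0r]] := boolP (reaches_root f).
  have [d fd] := reaches_root_depth fr.
  rewrite (det_fmx_ranked (d := d)) => [|x y].
    rewrite big1 // => x _; rewrite /parent_row eqxx.
    have [//|xr /=] := eqVneq x r; have := fd _ xr.
    by case: eqP => [<- | _]; rewrite ?ltnn ?subr0.
  rewrite /parent_row; have [-> | _] := eqVneq y x; first by left.
  have [->|xr] := eqVneq x r; first by rewrite subr0 eqxx.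
  case: (eqVneq y (f x)) => [-> _ | _]; first by right; exact: fd.
  by rewrite andbF subr0 eqxx.
(* The set of vertices that never reach the root is stable under f and under
   preimages by f, so each row e_x - e_(f x) is orthogonal to its indicator. *)
apply: (@det_fmx_kernel _ _ _ (fun x => (~~ fconnect f x r)%:R) x0).
  by rewrite x0r.
move=> x; under eq_bigr => y _ do rewrite mulrBl.
rewrite sumrB (bigD1 x) //= eqxx mul1r big1 ?addr0 => [|y /negPf->]; last first.
  by rewrite mul0r.
have [->|xr] := eqVneq x r.
  by rewrite connect0 big1 ?subrr // => y _; rewrite mul0r.
rewrite (bigD1 (f x)) //= eqxx mul1r big1 ?addr0 => [|y /negPf->]; last first.
  by rewrite mul0r.
by rewrite fconnect_step // subrr.
Qed.

Lemma det_root_laplacian : \det (fmx root_laplacian) = #|parent_functions|%:R.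
Proof.
pose row (x u y : G) : int := (y == x)%:R - ((x != r) && (y == u))%:R.
rewrite (@eq_fmx _ _ _ (fun x y => \sum_(u | parent_ok x u) row x u y))
    => [|x y].
  rewrite det_fmx_rows (eq_bigr _ det_parent_row) -natr_sum -sum1_card.
  congr _%:R.
  rewrite [RHS](eq_bigl (fun f => (f \in family parent_ok) && reaches_root f)).
    by rewrite [RHS]big_mkcondr; apply: eq_bigr => f _; case: reaches_root.
  by move=> f; rewrite inE.
rewrite /root_laplacian /parent_ok /row; case: eqP => [->|_] //=.
by rewrite big_pred1_eq subr0.
Qed.

Definition parent_edges f : {set {set G}} := [set [set x; f x] | x in predC1 r].

Lemma set2_eq (x y z w : G) : [set x; y] = [set z; w] ->
  x = z /\ y = w \/ x = w /\ y = z.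
Proof.
move=> /setP E; have /[!inE]/esym := E x; have /[!inE]/esym := E y.
have /[!inE] := E z; have /[!inE] := E w; rewrite !eqxx ?orbT /=.
do 4![case/orP=> /eqP ?]; subst; auto.
Qed.

Lemma parent_edgesP f x y :
  reflect (x != r /\ f x = y \/ y != r /\ f y = x)
          ([set x; y] \in parent_edges f).
Proof.
apply: (iffP imsetP) => [[z /[!inE] zr] | [[xr <-]|[yr <-]]].
- by case/set2_eq => -[-> ->]; [left | right].
- by exists x.
- by exists y; rewrite // setUC.
Qed.

Lemma parent_edges_connected f : reaches_root f ->
  connected (spanning_subgraph (parent_edges f)).
Proof.
move=> /reaches_root_depth[d fd].
have e_sym : connect_sym (spanning_adj (parent_edges f)).
  exact/sym_connect_sym/spanning_adj_sym.
suff er x : connect (spanning_adj (parent_edges f)) x r.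
  apply/forallP => x; apply/forallP => y.
  by apply: connect_trans (er x) _; rewrite e_sym er.
have [k] := ubnP (d x); elim: k x => // k IHk x /ltnSE le_k.
have [->|xr] := eqVneq x r; first exact: connect0.
apply: connect_trans (IHk _ (leq_trans (fd _ xr) le_k)); apply: connect1.
apply/andP; split; last by apply/parent_edgesP; left.
by apply: contraTneq (fd _ xr) => <-; rewrite ltnn.
Qed.

(** A vertex of a cycle that is deepest in it has both its neighbours along the
    cycle as parent, but these are distinct. *)
Lemma parent_edges_acyclic f : reaches_root f ->
  acyclic (spanning_subgraph (parent_edges f)).
Proof.
move=> /reaches_root_depth[d fd]; apply/acyclicP => c.
apply/negP => /and3P[c3 Uc Cc].
have [x0 x0c] : exists x0, x0 \in c.
  by case: c c3 {Uc Cc} => // x ? _; exists x; rewrite mem_head.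
have [x xc xmax] := @arg_maxnP _ x0 (mem c) d x0c.
have parent y : y \in c -> spanning_adj (parent_edges f) x y -> f x = y.
  move=> yc /andP[_ /parent_edgesP[[]//|[yr fy]]].
  by have := fd _ yr; rewrite fy ltnNge [(_ <= _)%N]xmax.
have nx : f x = next c x.
  by apply: parent; [rewrite mem_next | apply: (next_cycle Cc)].
have px : f x = prev c x.
  apply: parent; first by rewrite mem_prev.
  by rewrite spanning_adj_sym; apply: (prev_cycle Cc).
by have := next_neq_prev c3 Uc xc; rewrite -nx px eqxx.
Qed.

(** By induction on depth: the edge from [x] to [f x] is also an edge of [g]; if
    it were [g (f x) = x], then [f (f x) = x] by induction, and [x] would be less
    deep than its own parent. *)
Lemma parent_edges_inj f g : f \in parent_functions -> g \in parent_functions ->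
  parent_edges f = parent_edges g -> f = g.
Proof.
rewrite !inE => /andP[/familyP okf fr] /andP[/familyP okg _] E.
have root h : (forall x, h x \in parent_ok x) -> h r = r.
  by move=> /(_ r); rewrite unfold_in /parent_ok eqxx => /eqP.
have [d fd] := reaches_root_depth fr.
apply/ffunP => x; have [k] := ubnP (d x); elim: k x => // k IHk x /ltnSE le_k.
have [->|xr] := eqVneq x r; first by rewrite !root.
have lt_k := leq_trans (fd _ xr) le_k.
have: [set x; f x] \in parent_edges f by apply/parent_edgesP; left.
rewrite E => /parent_edgesP[[]//|[fxr]]; rewrite -IHk // => ffx.
by have := fd _ fxr; rewrite ffx ltnNge ltnW // fd.
Qed.

(** Take for [f] a step towards the root that decreases the distance in [F].
    Its edges already connect the graph, so any further edge of [F] would close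
    a cycle. *)
Lemma spanning_tree_parent_edges F : F \subset edges G ->
  tree (spanning_subgraph F) ->
  exists2 f, f \in parent_functions & F = parent_edges f.
Proof.
move=> sFG /andP[/forallP conF /acyclicP acF].
have ex x : exists k,
    [exists p : k.-tuple G, path (spanning_adj F) x p && (last x p == r)].
  have /forallP/(_ r)/connectP[p pp pr] := conF x.
  by exists (size p); apply/existsP; exists (in_tuple p); rewrite pp -pr eqxx.
pose d x := ex_minn (ex x).
have nearer x : x != r -> exists u, spanning_adj F x u && (d u < d x)%N.
  move=> xr; rewrite /d; case: (ex_minnP (ex x)) => k /existsP[p] + _.
  case: p => -[|u p] /= /eqP <-; first by rewrite (negPf xr).
  move=> /andP[/andP[xu pp] pr]; exists u; rewrite xu /=.
  case: ex_minnP => l _; apply; apply/existsP; exists (in_tuple p).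
  by rewrite pp pr.
pose f := [ffun x => if x == r then r else
  odflt r [pick u | spanning_adj F x u && (d u < d x)%N]].
have fE x : x != r -> spanning_adj F x (f x) && (d (f x) < d x)%N.
  move=> xr; rewrite ffunE (negPf xr); case: pickP => //= no.
  by have [u] := nearer _ xr; rewrite no.
have fr : f r = r by rewrite ffunE eqxx.
have reach : reaches_root f.
  apply/forallP => x.
  have [k] := ubnP (d x); elim: k x => // k IHk x /ltnSE le_k.
  have [->|xr] := eqVneq x r; first exact: connect0.
  have /andP[_ ltd] := fE _ xr.
  by rewrite -fconnect_step // IHk // (leq_trans ltd).
exists f.
  rewrite inE reach andbT; apply/familyP => x; rewrite unfold_in /parent_ok.
  case: eqVneq => [->|xr]; first by rewrite fr.
  have /andP[/andP[_ xfF] _] := fE _ xr.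
  have /imset2P[y z _ /[!inE] /= yz /set2_eq] := subsetP sFG _ xfF.
  by case=> -[-> ->] //; rewrite adj_sym.
have sub : parent_edges f \subset F.
  apply/subsetP => _ /imsetP[x /[!inE] xr ->].
  by have /andP[/andP[]] := fE _ xr.
apply/eqP; rewrite eqEsubset sub andbT; apply/subsetP => A AF.
have /imset2P[x y _ /[!inE] /= xy AE] := subsetP sFG _ AF.
rewrite {A}AE in AF *; apply: contraT => xyNf.
have /forallP/(_ x)/forallP/(_ y)/connectP[p0 pp0 yE] :=
  parent_edges_connected reach.
case/shortenP: pp0 yE => p pp Up _ yE.
have xDy : x != y by apply: contraTneq xy => <-; rewrite adj_irrefl.
have := acF (x :: p); rewrite Up /= rcons_path -yE => /negP[].
rewrite spanning_adj_sym {2}/spanning_adj xDy AF andbT; apply/andP; split.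
  case: p pp yE {Up} => [|u [|v p]] //=.
    by move=> _ yx; rewrite yx eqxx in xDy.
  by rewrite andbT => /andP[_] + yu; rewrite -yu (negPf xyNf).
rewrite andbT; apply: sub_path pp => u v /andP[uv].
by rewrite /spanning_adj uv; apply: (subsetP sub).
Qed.

(** The form in which the eigenvectors of the Laplacian are checked. *)
Lemma root_laplacian_apply (v : G -> int) x :
  \sum_z root_laplacian x z * v z =
    if x == r then v r else \sum_(u | adj x u) (v x - v u).
Proof.
have pick z0 : \sum_z (z == z0)%:R * v z = v z0.
  rewrite (bigD1 z0) //= eqxx mul1r big1 ?addr0 // => z /negPf->.
  by rewrite mul0r.
rewrite /root_laplacian; case: eqP => _; first exact: pick.
under eq_bigr => z _ do rewrite mulr_suml.
rewrite exchange_big; apply: eq_bigr => u _.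
by under eq_bigr => z _ do rewrite mulrBl; rewrite sumrB !pick.
Qed.

Theorem matrix_tree : (tau G)%:R = \det (fmx root_laplacian).
Proof.
rewrite det_root_laplacian; congr _%:R.
rewrite /tau -(card_in_imset parent_edges_inj).
apply: eq_card => F; rewrite inE.
apply/andP/imsetP => [[sFG tF]|[f /[!inE]/andP[/familyP okf fr] ->]].
  by have [f] := spanning_tree_parent_edges sFG tF; exists f.
split; last by rewrite /tree parent_edges_connected ?parent_edges_acyclic.
apply/subsetP => _ /imsetP[x /[!inE] xr ->]; apply/imset2P.
exists x (f x) => //; rewrite inE /=.
by have := okf x; rewrite unfold_in /parent_ok (negPf xr).
Qed.
End MatrixTree.

(** * The Laplacian of the network *)

Lemma sum_ord_pick (m k : nat) (h : nat -> int) :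
  \sum_(j < m) (j == k :> nat)%:R * h j = (k < m)%:R * h k.
Proof.
case: ltnP => [lt_km | le_mk].
  rewrite (bigD1 (Ordinal lt_km)) //= eqxx big1 ?addr0 // => j.
  by rewrite -val_eqE /= => /negPf->; rewrite mul0r.
rewrite mul0r big1 // => j _.
by rewrite (ltn_eqF (leq_trans (ltn_ord j) le_mk)) mul0r.
Qed.

Section Network.
Variable n : nat.
Let m := (4 * n + 1)%N.

Lemma adj_Q (x u : Q n) :
  (adj x u)%:R = (u.1 == x.1.+1 :> nat)%:R
    + (0 < x.1)%:R * (u.1 == x.1.-1 :> nat)%:R
    + (is_rung n x.1.+1)%:R * ((u.1 == x.1 :> nat)%:R * (u.2 == ~~ x.2)%:R) :> int.
Proof.
case: x u => i b [j c].
rewrite /= /Qadj /Qarc /Qpath /Qcross /Qrung /label /primed /=.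
rewrite ![(_.+1 + 1)%N]addn1 !eqSS !(eq_sym c b).
have [->|ij] := eqVneq (j : nat) i.
  by move: (is_rung _ _); case: b c => -[] []; lia.
case: (b == c) => /=; rewrite ?andbF ?andbT ?orbF /=; lia.
Qed.

Lemma laplacian_Q (p : nat -> bool -> int) (x : Q n) :
  \sum_(u : Q n | adj x u) (p x.1 x.2 - p u.1 u.2) =
    (x.1 < 4 * n)%:R * (p x.1 x.2 *+ 2 - p x.1.+1 false - p x.1.+1 true)
    + (0 < x.1)%:R * (p x.1 x.2 *+ 2 - p x.1.-1 false - p x.1.-1 true)
    + (is_rung n x.1.+1)%:R * (p x.1 x.2 - p x.1 (~~ x.2)).
Proof.
case: x => i b; set q := p i b.
rewrite big_mkcond.
rewrite (eq_bigr (fun u : Q n => (adj ((i, b) : Q n) u)%:R * (q - p u.1 u.2)));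
  last first.
  by move=> u _; case: adj; rewrite ?mul1r ?mul0r.
pose h j := q *+ 2 - p j false - p j true.
transitivity (\sum_(j < m) ((j == i.+1 :> nat)%:R * h j
   + (0 < i)%:R * ((j == i.-1 :> nat)%:R * h j)
   + (is_rung n i.+1)%:R * ((j == i :> nat)%:R * (q - p j (~~ b))))).
  rewrite -(pair_bigA _ (fun (j : 'I_m) c =>
    (adj ((i, b) : Q n) (j, c))%:R * (q - p j c))) /=.
  apply: eq_bigr => j _; rewrite big_bool !adj_Q /= /h.
  by case: (b); rewrite /=; ring.
rewrite !big_split /= -!mulr_sumr !(sum_ord_pick _ _ h).
rewrite (sum_ord_pick _ _ (fun j => q - p j (~~ b))) /h.
have -> : (i.+1 < m)%N = (i < 4 * n)%N by rewrite /m; lia.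
have -> : (i.-1 < m)%N by rewrite /m; have := ltn_ord i; lia.
by rewrite ltn_ord !mul1r.
Qed.

(** Value at the vertex [(j, b)] of the vector [a_k] if [c], and [s_k] otherwise:
    the difference of the twins of layer [k], and the indicator of the layers
    from [k] on. *)
Definition basis_fun (k : nat) (c : bool) (j : nat) (b : bool) : int :=
  if c then (j == k)%:R * (if b then 1 else -1) else (k <= j)%N%:R.

Definition change_basis (z y : Q n) : int := basis_fun y.1 y.2 z.1 z.2.

(** Elementary row operation that splits each 2 by 2 diagonal block formed by
    [s_k] and [a_k] into a triangular one. *)
Definition add_twin_row (x z : Q n) : int :=
  (z == x)%:R + (~~ x.2 && (z == (x.1, true)))%:R.

Definition antisym_eigenvalue (i : nat) : int :=
  (0 < i)%:R *+ 2 + (i < 4 * n)%:R *+ 2 + (is_rung n i.+1)%:R *+ 2.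

Definition root : Q n := (Ordinal (ltn_addl (4 * n) (ltn0Sn 0)), false).

Lemma eq_root (x : Q n) : (x == root) = (x.1 == 0 :> nat) && ~~ x.2.
Proof. by case: x => i b; rewrite /root xpair_eqE eqbF_neg. Qed.

Lemma add_twin_row_apply (v : Q n -> int) x :
  \sum_z add_twin_row x z * v z = v x + (~~ x.2)%:R * v (x.1, true).
Proof.
under eq_bigr => z _ do rewrite mulrDl.
rewrite big_split /= (bigD1 x) //= eqxx mul1r big1 => [|z /negPf->];
  last by rewrite mul0r.
rewrite addr0.
congr (_ + _); rewrite (bigD1 (x.1, true)) //= eqxx andbT.
by rewrite big1 ?addr0 // => z /negPf->; rewrite andbF mul0r.
Qed.

(** On [s_k] only the edges between the layers [k.-1] and [k] contribute, and
    [a_k] is an eigenvector; the row of the root just evaluates the vector. *)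
Lemma laplacian_basis (x y : Q n) :
  \sum_z root_laplacian root x z * change_basis z y =
  if x == root then
    (if y.2 then - (y.1 == 0 :> nat)%:R else (y.1 == 0 :> nat)%:R)
  else if y.2 then antisym_eigenvalue x.1 * change_basis x y
  else ((0 < x.1) && (y.1 == x.1 :> nat))%N%:R *+ 2
       - (y.1 == x.1.+1 :> nat)%:R *+ 2.
Proof.
rewrite (root_laplacian_apply root (fun z => change_basis z y) x).
have [_|xr] := eqVneq x root.
  case: y => k [] /=;
    by rewrite /change_basis /= /basis_fun ?mulrN1 ?leqn0 // eq_sym.
rewrite /change_basis (laplacian_Q (basis_fun y.1 y.2)) /antisym_eigenvalue.
case: x {xr} => i b; case: y => k c /=; have := ltn_ord k; have := ltn_ord i.
rewrite /basis_fun => lti ltk; case: c.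
  have [ik|ik] := eqVneq (i : nat) k.
    have -> : (i.+1 == k) = false by lia.
    rewrite !mul0r subr0; have [i0|i0] := ltnP 0 i; last by case: b => /=; ring.
    have -> : (i.-1 == k) = false by lia.
    by case: b => /=; ring.
  by rewrite !mul0r; ring.
rewrite subrr mulr0 addr0.
have [i4n|i4n] := ltnP i (4 * n); have [i0|i0] := ltnP 0 i;
  rewrite ?mul1r ?mul0r /=; lia.
Qed.

(** * Evaluation of the determinant *)

Lemma det_add_twin_row : \det (fmx add_twin_row) = 1.
Proof.
rewrite (det_fmx_ranked (d := fun x => ~~ x.2)) => [|x y].
  rewrite big1 // => -[i b] _; rewrite /add_twin_row eqxx /= xpair_eqE eqxx /=.
  by case: b.
rewrite /add_twin_row; have [->|_] := eqVneq y x; first by left.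
by have [->|] := eqVneq y (x.1, true); case: x => i [] //=; right.
Qed.

(** The row operation makes the basis matrix triangular as well, with pivot 2 in
    row [s_k] and 1 in row [a_k]. *)
Lemma det_add_twin_change_basis :
  \det (fmx add_twin_row *m fmx change_basis) = 2 ^+ m.
Proof.
rewrite fmx_mul (eq_fmx (fun x y => add_twin_row_apply (change_basis^~ y) x)).
rewrite (det_fmx_ranked (d := fun x : Q n => (2 * x.1 + x.2)%N))
  => [|[i b] [k c]].
  rewrite -(pair_bigA _ (fun (i : 'I_m) b => change_basis (i, b) (i, b) +
     (~~ b)%:R * change_basis (i, true) (i, b))) /=.
  under eq_bigr => i _.
    rewrite big_bool /change_basis /basis_fun /= eqxx leqnn mul0r addr0 !mul1r.
    over.
  by rewrite prodr_const card_ord.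
rewrite /change_basis /basis_fun /=.
have [/val_inj ->|ik] := eqVneq (i : nat) k.
  by case: b c => -[] /=; rewrite ?leqnn ?mul1r ?addNr ?eqxx; auto; right; lia.
case: b c => -[] /=; rewrite ?mul0r ?mulr0 ?addr0 ?eqxx // => nz; right;
  by move: nz ik; case: leqP => //=; lia.
Qed.

(** Product of the two diagonal entries of [triangular_form] in layer [i]. *)
Definition layer_pivot (i : nat) : int :=
  antisym_eigenvalue i * (if (i == 0)%N then 1 else 4).

(** The product of the row operation, the rooted Laplacian and the basis. In
    layer 0 the root makes the entries differ from the general pattern. *)
Definition triangular_form (x y : Q n) : int :=
  if x.2 then
    if y.2 then (y.1 == x.1 :> nat)%:R * antisym_eigenvalue x.1
    else ((0 < x.1) && (y.1 == x.1 :> nat))%N%:R *+ 2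
         - (y.1 == x.1.+1 :> nat)%:R *+ 2
  else if x.1 == 0 :> nat then
    if y.2 then (y.1 == 0 :> nat)%:R *+ 3
    else (y.1 == 0 :> nat)%:R - (y.1 == 1 :> nat)%:R *+ 2
  else if y.2 then 0
    else (y.1 == x.1 :> nat)%:R *+ 4 - (y.1 == x.1.+1 :> nat)%:R *+ 4.

(** Row [s_k] involves [s_(k.+1)], and row [a_k] involves [s_k] and
    [s_(k.+1)], so the rank decreases with the layer and puts [a_k] above
    [s_k]. In layer 0 it is row [s_0] that involves [a_0], because of the root,
    and the two are ranked in the opposite order. *)
Lemma det_triangular_form : (0 < n)%N ->
  \det (fmx add_twin_row *m fmx (root_laplacian root) *m fmx change_basis)
    = \prod_(i < m) layer_pivot i.
Proof.
move=> n0; rewrite -mulmxA !fmx_mul.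
pose rank (x : Q n) :=
  (if x.1 == 0 :> nat then m.*2 - x.2 else (m - x.1).*2 + x.2)%N.
have E x y : \sum_z add_twin_row x z *
      \sum_z0 root_laplacian root z z0 * change_basis z0 y = triangular_form x y.
  rewrite /triangular_form add_twin_row_apply !laplacian_basis.
  rewrite /change_basis /basis_fun.
  case: x y => i b [k c] /=; rewrite !eq_root /= (eq_sym (i : nat) k).
  case: b => /=; first by rewrite andbF mul0r addr0; case: c => //=; ring.
  rewrite andbT andbF mul1r; case: (eqVneq (i : nat) 0) => [->|i0].
    rewrite ltnn andFb; case: c => //=; last by ring.
    have -> : antisym_eigenvalue 0 = 4.
      rewrite /antisym_eigenvalue /is_rung eqxx mul0rn add0r.
      by rewrite muln_gt0 n0.
    ring.
  rewrite lt0n i0 /=; case: c => /=; ring.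
rewrite (eq_fmx E) (det_fmx_ranked (d := rank)) => [|[i b] [k c]].
  rewrite -(pair_bigA _ (fun (i : 'I_m) b => triangular_form (i, b) (i, b))) /=.
  apply: eq_bigr => i _.
  rewrite big_bool /triangular_form /layer_pivot /= !eqxx mul1r; congr (_ * _).
  by rewrite (ltn_eqF (ltnSn i)); case: eqP => [->|].
rewrite /rank /triangular_form /=; have ltk : (k < m)%N := ltn_ord k.
have lti : (i < m)%N := ltn_ord i.
have [/val_inj <-|ik] := eqVneq (k : nat) i.
  case: b c => -[] /=; auto;
    by case: (eqVneq (k : nat) 0%N) => k0 //= nz; right; lia.
case: b c => -[] /=; rewrite ?mul0r // => nz; right; move: nz;
  case: (eqVneq (k : nat) 0%N) => k0; case: (eqVneq (i : nat) 0%N) => i0; lia.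
Qed.

(** In positions counted from 0 the rungs are periodic, the first and the last
    layer included. *)
Lemma is_rungE i : (i <= 4 * n)%N ->
  is_rung n i.+1 = (i %% 4 == 0)%N || (i %% 4 == 3)%N.
Proof.
move=> le_i; rewrite /is_rung; apply/idP/idP.
  case/orP=> [/eqP[->] //|/existsP[k /andP[_ /orP[]/eqP]]]; lia.
case/orP=> i4; last first.
  have lt : ((i %/ 4).+1 < n.+1)%N by lia.
  by apply/orP; right; apply/existsP; exists (Ordinal lt) => /=; lia.
have [->|i0] := eqVneq i 0%N; first by rewrite eqxx.
have lt : (i %/ 4 < n.+1)%N by lia.
by apply/orP; right; apply/existsP; exists (Ordinal lt) => /=; lia.
Qed.

(** Four consecutive interior layers contribute [24 * 16 * 16 * 24]. Extending
    this pattern to layer 0, whose pivot is 4 and not 24, explains the factor 6;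
    the factor 16 is the pivot of the last layer. *)
Lemma prod_layer_pivot : (0 < n)%N ->
  6 * \prod_(i < m) layer_pivot i = (2 ^+ 14 * 3 ^+ 2) ^+ n * 16.
Proof.
move=> n0; pose g i : int :=
  if (i %% 4 == 0)%N || (i %% 4 == 3)%N then 24 else 16.
have <- : \prod_(i < 4 * n) g i = (2 ^+ 14 * 3 ^+ 2) ^+ n.
  elim: n {n0} => [|k IHk]; first by rewrite muln0 big_ord0.
  rewrite exprS -IHk mulnS addnC addn4; do 4!rewrite big_ord_recr /=.
  have -> : g (4 * k)%N = 24 by rewrite /g; case: ifP => //; lia.
  have -> : g (4 * k).+1 = 16 by rewrite /g; case: ifP => //; lia.
  have -> : g (4 * k).+2 = 16 by rewrite /g; case: ifP => //; lia.
  have -> : g (4 * k).+3 = 24 by rewrite /g; case: ifP => //; lia.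
  by ring.
have pivotE i : (0 < i < 4 * n)%N -> layer_pivot i = g i.
  case/andP=> i0 lt_i.
  rewrite /layer_pivot /antisym_eigenvalue is_rungE ?(ltnW lt_i) //.
  by rewrite i0 lt_i /g (gtn_eqF i0); case: (_ || _).
have pivot0 : layer_pivot 0 = 4.
  by rewrite /layer_pivot /antisym_eigenvalue is_rungE // muln_gt0 n0.
have pivot_last : layer_pivot (4 * n) = 16.
  rewrite /layer_pivot /antisym_eigenvalue is_rungE // ltnn muln_gt0 n0 modnMr /=.
  by rewrite (gtn_eqF (_ : 0 < 4 * n)%N) // muln_gt0 n0.
rewrite /m addn1 big_ord_recr /= pivot_last mulrA; congr (_ * _).
have [k kE] : exists k, (4 * n)%N = k.+1.
  by exists (4 * n).-1; rewrite prednK // muln_gt0.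
move: pivotE; rewrite kE !big_ord_recl => pivotE.
rewrite pivot0 mulrA; congr (_ * _).
by apply: eq_bigr => i _; apply: pivotE; rewrite /= ltnS ltn_ord.
Qed.
End Network.

(** The factor [2 ^ (4 * n + 1)] is the determinant of the change of basis. *)
Lemma tau_Q_relation (n : nat) : (0 < n)%N ->
  (6 * 2 ^ (4 * n + 1) * tau (Q n) = (2 ^ 14 * 3 ^ 2) ^ n * 2 ^ 4)%N.
Proof.
move=> n0; have := det_triangular_form n0 => /(congr1 ( *%R 6)).
rewrite prod_layer_pivot // !det_mulmx -matrix_tree.
have := det_add_twin_change_basis n.
rewrite det_mulmx det_add_twin_row !mul1r => -> tauE.
apply/eqP; rewrite -(eqr_nat int) !(natrM, natrX); apply/eqP.
by rewrite -mulrA [_ * (tau _)%:R]mulrC tauE.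
Qed.

Local Close Scope ring_scope.

Theorem theorem3p4 (n : nat) (hn : 1 <= n) :
  tau (Q n) = 2 ^ (10 * n + 2) * 3 ^ (2 * n - 1).
Proof.
have pos : 0 < 6 * 2 ^ (4 * n + 1) by rewrite muln_gt0 expn_gt0.
apply/eqP; rewrite -(eqn_pmul2l pos) tau_Q_relation // expnMn -!expnM.
have -> : 14 * n = 4 * n + 10 * n by lia.
set k := 2 * n - 1; have -> : 2 * n = k.+1 by rewrite /k; lia.
by rewrite expnS !expnD; apply/eqP; ring.
Qed.
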